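(* Let $q\in\mathbb{I}$ be admissible and primitive, and let $q_\alpha=\alpha_q q$ be its extension. Then the coincidence site lattice defined by $q$ is given by $$L\cap\frac{1}{|q\widetilde q|}\,qL\widetilde q\;=\;L(q_\alpha),$$ where $L(q_\alpha)=\{q_\alpha x+\widetilde x\,\widetilde{q_\alpha}\mid x\in\mathbb{I}\}$.
   Context: Let $K=\mathbb{Q}(\sqrt5)$, $\tau=(1+\sqrt5)/2$, $\mathfrak{o}=\mathbb{Z}[\tau]$ (the ring of integers of $K$, a principal ideal domain), $\mathbb{N}=\{1,2,3,\dots\}$, and let ${}'$ denote the algebraic conjugation of $K$ induced by $\sqrt5\mapsto-\sqrt5$. Let $\mathbb{H}(K)=K\oplus \mathrm{i}K\oplus \mathrm{j}K\oplus \mathrm{k}K$ be the Hamilton quaternion algebra over $K$ ($\mathrm{i}^2=\mathrm{j}^2=\mathrm{k}^2=\mathrm{ijk}=-1$), with elements written $q=(a,b,c,d)=a+\mathrm{i}b+\mathrm{j}c+\mathrm{k}d$. Put $\bar q=(a,-b,-c,-d)$, $\mathrm{nr}(q)=q\bar q=|q|^2$, with $|q|$ the Euclidean length. The twist map is $\widetilde q=(a',b',d',c')$; one has $\mathrm{nr}(\widetilde q)=\mathrm{nr}(q)'$. The icosian ring is $$\mathbb{I}=\big\langle(1,0,0,0),(0,1,0,0),\tfrac12(1,1,1,1),\tfrac12(1-\tau,\tau,0,1)\big\rangle_{\mathfrak{o}},$$ and $$L=\big\langle(1,0,0,0),\tfrac12(-1,1,1,1),(0,-1,0,0),\tfrac12(0,1,\tau-1,-\tau)\big\rangle_{\mathbb{Z}}\subset\mathbb{I}$$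 is a copy of the root lattice $A_4$ in $\mathbb{R}^4$. An element $q\in\mathbb{I}$ is primitive if $\alpha q\in\mathbb{I}$ with $\alpha\in K$ implies $\alpha\in\mathfrak{o}$. An element $q\in\mathbb{I}$ is admissible if $|q\widetilde q|\in\mathbb{N}$. For $q\in\mathbb{I}$ primitive and admissible, put $$\alpha_q=\sqrt{\frac{\mathrm{lcm}(\mathrm{nr}(q),\mathrm{nr}(q)')}{\mathrm{nr}(q)}}\in\mathfrak{o},$$ where the least common multiple in $\mathfrak{o}$ (a generator of $\mathrm{nr}(q)\mathfrak{o}\cap\mathrm{nr}(q)'\mathfrak{o}$) is normalised to be a positive rational integer, which is possible for such $q$; $\alpha_q$ matters only up to units of $\mathfrak{o}$. The icosian $q_\alpha=\alpha_q q$ is called the extension of $q$. *)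

(* Defs.v *)
From HB Require Import structures.
From mathcomp Require Import all_boot all_order all_algebra.
From mathcomp Require Import ring.
From mathcomp Require Import boolp classical_sets reals.
Set Implicit Arguments.
Unset Strict Implicit.
Unset Printing Implicit Defensive.
Import Order.TTheory GRing.Theory Num.Theory.
Local Open Scope classical_set_scope.
Local Open Scope ring_scope.

(* [QSqrt5 a b] stands for a + b sqrt 5. *)
Record qsqrt5 := QSqrt5 { ratpart : rat; sqrtpart : rat }.

Section QSqrt5Field.

Let pair_of (x : qsqrt5) := (ratpart x, sqrtpart x).
Let of_pair (p : rat * rat) := QSqrt5 p.1 p.2.
Let pair_ofK : cancel pair_of of_pair. Proof. by case. Qed.

HB.instance Definition _ := Choice.copy qsqrt5 (can_type pair_ofK).

Implicit Types x y z : qsqrt5.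

Definition zeroK := QSqrt5 0 0.
Definition oneK := QSqrt5 1 0.
Definition oppK x := QSqrt5 (- ratpart x) (- sqrtpart x).
Definition addK x y := QSqrt5 (ratpart x + ratpart y) (sqrtpart x + sqrtpart y).
Definition mulK x y :=
  QSqrt5 (ratpart x * ratpart y + 5 * (sqrtpart x * sqrtpart y))
         (ratpart x * sqrtpart y + sqrtpart x * ratpart y).
Definition fnormK x := ratpart x ^+ 2 - 5 * sqrtpart x ^+ 2.
Definition invK x := QSqrt5 (ratpart x / fnormK x) (- sqrtpart x / fnormK x).

Let addKA : associative addK.
Proof. by move=> [a b] [c d] [e f]; rewrite /addK /= !addrA. Qed.
Let addKC : commutative addK.
Proof. by move=> [a b] [c d]; rewrite /addK /= addrC [b + d]addrC. Qed.
Let add0K : left_id zeroK addK.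
Proof. by move=> [a b]; rewrite /addK /= !add0r. Qed.
Let addNK : left_inverse zeroK oppK addK.
Proof. by move=> [a b]; rewrite /addK /= !addNr. Qed.

HB.instance Definition _ := GRing.isZmodule.Build qsqrt5 addKA addKC add0K addNK.

Let mulKA : associative mulK.
Proof. by move=> [a b] [c d] [e f]; rewrite /mulK /=; congr QSqrt5; ring. Qed.
Let mulKC : commutative mulK.
Proof. by move=> [a b] [c d]; rewrite /mulK /=; congr QSqrt5; ring. Qed.
Let mul1K : left_id oneK mulK.
Proof. by move=> [a b]; rewrite /mulK /=; congr QSqrt5; ring. Qed.
Let mulKDl : left_distributive mulK addK.
Proof.
by move=> [a b] [c d] [e f]; rewrite /mulK /addK /=; congr QSqrt5; ring.
Qed.
Let oneK_neq0 : oneK != 0.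
Proof. by apply/eqP => -[]. Qed.

HB.instance Definition _ :=
  GRing.Zmodule_isComNzRing.Build qsqrt5 mulKA mulKC mul1K mulKDl oneK_neq0.

Lemma sqr_rat_neq5 (r : rat) : r ^+ 2 != 5.
Proof.
apply/eqP => r2.
have d0 : (denq r)%:~R != 0 :> rat by rewrite intr_eq0 denq_neq0.
have /eqP : (numq r ^+ 2)%:~R = (5 * denq r ^+ 2)%:~R :> rat.
  by rewrite intrM !rmorphXn /= numqE exprMn r2.
rewrite eqr_int => /eqP /(congr1 absz); rewrite abszM !abszX => /(congr1 (logn 5)).
have dgt0 : (0 < `|denq r|)%N by rewrite absz_gt0 denq_neq0.
rewrite lognM ?expn_gt0 ?dgt0 // !lognX [logn 5 `|5|%N]/= => /(congr1 odd).
by rewrite oddD !oddM.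
Qed.

Lemma fnormK_eq0 x : (fnormK x == 0) = (x == 0).
Proof.
apply/eqP/eqP => [|->]; last by rewrite /fnormK /= expr0n mulr0 subr0.
case: x => a b; rewrite /fnormK /= => /eqP; rewrite subr_eq0 => /eqP ab.
have [b0|b0] := eqVneq b 0.
  move: ab; rewrite b0 expr0n mulr0 => /eqP; rewrite expf_eq0 /= => /eqP ->.
  by [].
case/eqP: (sqr_rat_neq5 (a / b)).
by rewrite expr_div_n ab mulfK // expf_neq0.
Qed.

Let mulVK x : x != 0 -> invK x * x = 1.
Proof.
rewrite -fnormK_eq0; case: x => a b n0.
rewrite /GRing.mul /= /mulK /=; congr QSqrt5; move: n0; rewrite /fnormK /= => n0.
  by field.
by field.
Qed.
Let invK0 : invK 0 = 0.
Proof. by rewrite /invK -[ratpart 0]/0 -[sqrtpart 0]/0 oppr0 !mul0r. Qed.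

HB.instance Definition _ := GRing.ComNzRing_isField.Build qsqrt5 mulVK invK0.

End QSqrt5Field.

Notation K := qsqrt5.

Definition tau : K := QSqrt5 (1 / 2) (1 / 2).

Definition conjK (x : K) : K := QSqrt5 (ratpart x) (- sqrtpart x).

Definition real_of_K (R : realType) (x : K) : R :=
  ratr (ratpart x) + ratr (sqrtpart x) * Num.sqrt 5.

Definition ZK : set K := [set m%:~R | m in [set: int]].
(* The ring of integers Z[tau]. *)
Definition oK : set K := [set m%:~R + n%:~R * tau | m in [set: int] & n in [set: int]].

Definition principal (a : K) : set K := [set a * x | x in oK].

Record quat (F : Type) := Quat { qre : F; qi : F; qj : F; qk : F }.
Arguments Quat {F}.

Section QuatRing.
Variable F : comNzRingType.
Implicit Types (p q r : quat F) (a b : F).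

Let tuple_of q := (qre q, qi q, qj q, qk q).
Let of_tuple (t : F * F * F * F) := let: (a, b, c, d) := t in Quat a b c d.
Let tuple_ofK : cancel tuple_of of_tuple. Proof. by case. Qed.

HB.instance Definition _ := Choice.copy (quat F) (can_type tuple_ofK).

Definition qzero : quat F := Quat 0 0 0 0.
Definition qone : quat F := Quat 1 0 0 0.
Definition qopp q : quat F := Quat (- qre q) (- qi q) (- qj q) (- qk q).
Definition qadd p q : quat F :=
  Quat (qre p + qre q) (qi p + qi q) (qj p + qj q) (qk p + qk q).
Definition qmul p q : quat F :=
  Quat (qre p * qre q - qi p * qi q - qj p * qj q - qk p * qk q)
       (qre p * qi q + qi p * qre q + qj p * qk q - qk p * qj q)
       (qre p * qj q - qi p * qk q + qj p * qre q + qk p * qi q)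
       (qre p * qk q + qi p * qj q - qj p * qi q + qk p * qre q).
Definition qscale a q : quat F := Quat (a * qre q) (a * qi q) (a * qj q) (a * qk q).

Let qaddA : associative qadd.
Proof. by move=> [????] [????] [????]; congr Quat; rewrite /= addrA. Qed.
Let qaddC : commutative qadd.
Proof. by move=> [????] [????]; congr Quat; rewrite /= addrC. Qed.
Let qadd0 : left_id qzero qadd.
Proof. by move=> [????]; congr Quat; rewrite /= add0r. Qed.
Let qaddN : left_inverse qzero qopp qadd.
Proof. by move=> [????]; congr Quat; rewrite /= addNr. Qed.

HB.instance Definition _ := GRing.isZmodule.Build (quat F) qaddA qaddC qadd0 qaddN.

Let qmulA : associative qmul.
Proof. by move=> [????] [????] [????]; congr Quat => /=; ring. Qed.
Let qmul1 : left_id qone qmul.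
Proof. by move=> [????]; congr Quat => /=; ring. Qed.
Let qmulr1 : right_id qone qmul.
Proof. by move=> [????]; congr Quat => /=; ring. Qed.
Let qmulDl : left_distributive qmul qadd.
Proof. by move=> [????] [????] [????]; congr Quat => /=; ring. Qed.
Let qmulDr : right_distributive qmul qadd.
Proof. by move=> [????] [????] [????]; congr Quat => /=; ring. Qed.
Let qone_neq0 : qone != 0.
Proof. by apply/eqP => -[] /eqP; rewrite oner_eq0. Qed.

HB.instance Definition _ :=
  GRing.Zmodule_isNzRing.Build (quat F) qmulA qmul1 qmulr1 qmulDl qmulDr qone_neq0.

Let qscaleA a b q : qscale a (qscale b q) = qscale (a * b) q.
Proof. by congr Quat; rewrite /= mulrA. Qed.
Let qscale1 : left_id 1 qscale.
Proof. by move=> [????]; congr Quat; rewrite /= mul1r. Qed.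
Let qscaleDr : right_distributive qscale +%R.
Proof. by move=> a [????] [????]; congr Quat; rewrite /= mulrDr. Qed.
Let qscaleDl q : {morph qscale^~ q : a b / a + b}.
Proof. by move=> a b; congr Quat; rewrite /= mulrDl. Qed.

HB.instance Definition _ :=
  GRing.Zmodule_isLmodule.Build F (quat F) qscaleA qscale1 qscaleDr qscaleDl.

Definition qconj q : quat F := Quat (qre q) (- qi q) (- qj q) (- qk q).
Definition nr q : F := qre q ^+ 2 + qi q ^+ 2 + qj q ^+ 2 + qk q ^+ 2.

Lemma mulq_conj q : q * qconj q = Quat (nr q) 0 0 0.
Proof. by case: q => a b c d; congr Quat; rewrite /nr /=; ring. Qed.

End QuatRing.

Notation HK := (quat K).

(* The last two coordinates are exchanged. *)
Definition twist (q : HK) : HK :=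
  Quat (conjK (qre q)) (conjK (qi q)) (conjK (qk q)) (conjK (qj q)).

(* Euclidean lengths live in R, hence the embedding of H(K) in H(R). *)

Section Reals.
Variable R : realType.

Definition quat_of_K (q : HK) : quat R :=
  Quat (real_of_K R (qre q)) (real_of_K R (qi q))
       (real_of_K R (qj q)) (real_of_K R (qk q)).

Definition qlen (x : quat R) : R := Num.sqrt (nr x).

(* |q q~| *)
Definition twist_len (q : HK) : R := qlen (quat_of_K (q * twist q)).

End Reals.

Definition lattice_span (S : set K) (e : seq HK) : set HK :=
  [set \sum_(i < size e) c i *: e`_i | c in [set c : nat -> K | forall i, S (c i)]].

Definition icosian : set HK := lattice_span oK
  [:: Quat 1 0 0 0;
      Quat 0 1 0 0;
      2^-1 *: Quat 1 1 1 1;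
      2^-1 *: Quat (1 - tau) tau 0 1].

(* A copy of the root lattice A_4. *)
Definition latL : set HK := lattice_span ZK
  [:: Quat 1 0 0 0;
      2^-1 *: Quat (-1) 1 1 1;
      Quat 0 (-1) 0 0;
      2^-1 *: Quat 0 1 (tau - 1) (- tau)].

Definition primitive (q : HK) : Prop :=
  icosian q /\ forall a : K, icosian (a *: q) -> oK a.

Definition admissible (R : realType) (q : HK) : Prop :=
  icosian q /\ exists2 n : nat, (0 < n)%N & twist_len R q = n%:R.

(* The positive rational integer generating the intersection of the ideals of
   nr q and (nr q)'; at most one exists, and 0 is a junk value otherwise. *)
Definition lcm_nr (q : HK) : nat :=
  xget 0%N [set l : nat | (0 < l)%N /\
    principal l%:R = principal (nr q) `&` principal (conjK (nr q))].

(* The element of K whose real value is the square root of lcm_nr q / nr q;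
   at most one exists, and 0 is a junk value otherwise. *)
Definition alpha (R : realType) (q : HK) : K :=
  xget 0 [set a : K |
    real_of_K R a = Num.sqrt (real_of_K R ((lcm_nr q)%:R / nr q))].

Definition extension (R : realType) (q : HK) : HK := alpha R q *: q.

Definition latL_of (q : HK) : set HK :=
  [set q * x + twist x * twist q | x in icosian].

(* L `&` (1 / |q q~|) q L q~, as a subset of H(R). *)
Definition csl (R : realType) (q : HK) : set (quat R) :=
  [set quat_of_K R x | x in latL] `&`
  [set (twist_len R q)^-1 *:
         (quat_of_K R q * quat_of_K R y * quat_of_K R (twist q)) | y in latL].
Arguments csl : clear implicits.

(* Main.v *)
Require Import Defs.
From HB Require Import structures.
From mathcomp Require Import all_boot all_order all_algebra.
From mathcomp Require Import ring lra zify.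
From mathcomp Require Import boolp classical_sets reals.
Set Implicit Arguments.
Unset Strict Implicit.
Unset Printing Implicit Defensive.
Import Order.TTheory GRing.Theory Num.Theory.
Local Open Scope classical_set_scope.
Local Open Scope ring_scope.

(* Put [n = |q q~|], so that [nr q * (nr q)' = n ^ 2].  Since
   [(nr q + n) ^ 2 = nr q * (2 n + nr q + (nr q)')], one gets [nr q = u d ^ 2]
   with [u] a positive integer and [d], [d'] coprime.  Hence the lcm is
   [u (d d') ^ 2], [alpha_q] is [d'] up to sign, and [n] is [u d d'] up to sign.

   With [eta w = w + w~], the lattice [L] is [{z in I | z~ = z}], and it equals
   [eta I] because [tau + tau' = 1] gives [z = eta (tau z)] for [z] in [L].
   If [q] is primitive, unimodularity of the trace form of [I] yields [c] in [I]
   with [q c + conj (q c) = 1].  Expanding a point [z] of the coincidence lattice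
   with this identity on the left, its twist on the right, and a Bezout relation
   between [d] and [d'], one finds [z = d' q s + d t q~] with [s, t] in [I];
   then [z = tau z + tau' z~ = eta (d' q (tau s + tau' t~))]. *)

(** * Arithmetic of Z[tau] *)

Lemma conjK_is_zmod_morphism : zmod_morphism conjK.
Proof. by move=> [a b] [c d]; congr QSqrt5 => /=; ring. Qed.

Lemma conjK_is_monoid_morphism : monoid_morphism conjK.
Proof. by split=> [|[a b] [c d]]; congr QSqrt5 => /=; ring. Qed.

HB.instance Definition _ :=
  GRing.isZmodMorphism.Build K K conjK conjK_is_zmod_morphism.
HB.instance Definition _ :=
  GRing.isMonoidMorphism.Build K K conjK conjK_is_monoid_morphism.

Lemma conjKK : involutive conjK.
Proof. by case=> a b; rewrite /conjK /= opprK. Qed.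

Lemma tau_sqr : tau ^+ 2 = tau + 1.
Proof. by congr QSqrt5 => /=; field. Qed.

Lemma conj_tau : conjK tau = 1 - tau.
Proof. by congr QSqrt5 => /=; field. Qed.

Lemma natK_E (n : nat) : n%:R = QSqrt5 n%:R 0.
Proof. by elim: n => // n IH; rewrite -!natr1 IH; congr QSqrt5; rewrite /= addr0. Qed.

Lemma intK_E (m : int) : m%:~R = QSqrt5 m%:~R 0.
Proof. by case: m => n; rewrite ?NegzE ?mulrNz -!pmulrn natK_E. Qed.

Lemma intK_inj : injective (intr : int -> K).
Proof. by move=> m n; rewrite !intK_E => -[] /intr_inj. Qed.

Lemma natK_inj : injective (GRing.natmul (1 : K)).
Proof. by move=> m n; rewrite !natK_E => -[] /eqP; rewrite eqr_nat => /eqP. Qed.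

Lemma two_neq0 : 2 != 0 :> K.
Proof. by apply/eqP => /(@natK_inj 2 0). Qed.

Lemma oKP (x : K) : oK x <-> exists m n : int, x = m%:~R + n%:~R * tau.
Proof.
split=> [[m _ [n _ <-]]|[m [n ->]]]; first by exists m, n.
by exists m => //; exists n.
Qed.

Lemma oK_int (m : int) : oK m%:~R.
Proof. by apply/oKP; exists m, 0; rewrite mul0r addr0. Qed.

Lemma oK_nat (n : nat) : oK n%:R.
Proof. by rewrite pmulrn; apply: oK_int. Qed.

Lemma oK_tau : oK tau.
Proof. by apply/oKP; exists 0, 1; rewrite add0r mul1r. Qed.

Lemma oKD (x y : K) : oK x -> oK y -> oK (x + y).
Proof.
move=> /oKP[m [n ->]] /oKP[k [l ->]]; apply/oKP; exists (m + k), (n + l).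
by rewrite !intrD; ring.
Qed.

Lemma oKN (x : K) : oK x -> oK (- x).
Proof.
move=> /oKP[m [n ->]]; apply/oKP; exists (- m), (- n).
by rewrite !intrN; ring.
Qed.

Lemma oKM (x y : K) : oK x -> oK y -> oK (x * y).
Proof.
move=> /oKP[m [n ->]] /oKP[k [l ->]]; apply/oKP.
exists (m * k + n * l), (m * l + n * k + n * l).
by have t2 := tau_sqr; rewrite !(intrD, intrM); ring: t2.
Qed.

Lemma oK_conj (x : K) : oK x -> oK (conjK x).
Proof.
move=> /oKP[m [n ->]]; apply/oKP; exists (m + n), (- n).
by rewrite rmorphD rmorphM !rmorph_int /= conj_tau intrD intrN; ring.
Qed.

Ltac oK_closed := repeat match goal with
  | |- oK (_ + _) => apply: oKD
  | |- oK (- _) => apply: oKN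
  | |- oK (_ * _) => apply: oKM
  | |- oK (_ ^+ 2) => rewrite expr2
  | |- oK (conjK _) => apply: oK_conj
  | |- oK tau => exact: oK_tau
  | |- oK 0 => exact: (oK_nat 0)
  | |- oK 1 => exact: (oK_nat 1)
  | |- oK _%:R => exact: oK_nat
  | |- oK _%:~R => exact: oK_int
  | |- oK _ => assumption
  end.

(** Conjugation moves [m + n tau] by [- n sqrt 5], and [- sqrt 5] is the [QSqrt5 0 (-1)] below. *)
Lemma oK_conj_fixed (x : K) : oK x -> conjK x = x -> exists m : int, x = m%:~R.
Proof.
move=> /oKP[m [n ->]] => /eqP.
rewrite -subr_eq0 rmorphD rmorphM !rmorph_int /= conj_tau.
have -> : m%:~R + n%:~R * (1 - tau) - (m%:~R + n%:~R * tau) =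
   n%:~R * QSqrt5 0 (-1).
  have -> : QSqrt5 0 (-1) = 1 - 2 * tau by congr QSqrt5 => /=; field.
  by ring.
rewrite mulf_eq0 => /orP[/eqP n0|/eqP//].
by exists m; rewrite n0 mul0r addr0.
Qed.

(** * Euclidean division and Bezout relations *)

Lemma fnormKM (x y : K) : fnormK (x * y) = fnormK x * fnormK y.
Proof. by case: x y => [a b] [c d]; rewrite /fnormK /=; ring. Qed.

(** The norm of [m + n tau] is [m^2 + m n - n^2]; its absolute value is the termination measure of
    the Euclidean algorithm. *)
Lemma fnormK_oK (x : K) : oK x -> exists k : nat, `|fnormK x| = k%:R.
Proof.
move=> /oKP[m [n ->]].
exists (absz (m ^+ 2 + m * n - n ^+ 2)%R).
rewrite pmulrn abszE intr_norm; congr (`|_|).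
rewrite !intK_E /fnormK /= !(intrD, intrM, intrN, rmorphXn) /=.
by field.
Qed.

(** Round the coordinates [X], [Y] of [a / b] on the basis [1, tau]. The errors [u], [v] are at most
    1/2, so their norm [u^2 + u v - v^2] is below 1 in absolute value. *)
Lemma oK_euclid (a b : K) : oK a -> oK b -> b != 0 ->
  exists q r, [/\ oK q, oK r, a = b * q + r & `|fnormK r| < `|fnormK b|].
Proof.
move=> oa ob b0; set x := a / b.
pose X := ratpart x - sqrtpart x; pose Y := 2 * sqrtpart x.
pose m := Num.floor (X + 1 / 2); pose n := Num.floor (Y + 1 / 2).
pose q : K := m%:~R + n%:~R * tau.
have oq : oK q by apply/oKP; exists m, n.
exists q, (a - b * q); split; [by []|by oK_closed|by ring|].
have -> : a - b * q = b * (x - q) by rewrite mulrBr /x mulrCA divff // mulr1.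
rewrite fnormKM normrM gtr_pMr; last by rewrite normr_gt0 fnormK_eq0.
have -> : fnormK (x - q) =
    (X - m%:~R) ^+ 2 + (X - m%:~R) * (Y - n%:~R) - (Y - n%:~R) ^+ 2.
  rewrite /q /X /Y !intK_E; case: (x) => r s.
  by rewrite /fnormK /=; field.
have /andP[m1 m2] := floor_itv (X + 1 / 2).
have /andP[n1 n2] := floor_itv (Y + 1 / 2).
move: m1 m2 n1 n2; rewrite -/m -/n !intrD.
set u := X - _; set v := Y - _ => m1 m2 n1 n2.
have [u1 u2] : -1/2 <= u /\ u <= 1/2 by split; rewrite /u; lra.
have [v1 v2] : -1/2 <= v /\ v <= 1/2 by split; rewrite /v; lra.
rewrite ltr_norml; apply/andP; split; nra.
Qed.

(** Euclidean algorithm, by induction on a bound for the norm of [b]. The cofactors [a'], [b']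
    express that [d] divides both. *)
Lemma oK_bezout (a b : K) : oK a -> oK b ->
  exists d x y a' b', [/\ oK x, oK y, oK a', oK b'
    & [/\ a = d * a', b = d * b' & d = x * a + y * b]].
Proof.
move=> oa ob; have [k bk] := fnormK_oK ob.
have {bk} : `|fnormK b| < k.+1%:R by rewrite bk ltr_nat.
elim: k.+1 a b oa ob => [|{}k IH] a b oa ob; first by rewrite ltNge normr_ge0.
have [->|b0] := eqVneq b 0.
  move=> _; exists a, 1, 0, 1, 0; split; [oK_closed .. | ].
  by split; ring.
have [q [r [oq or e rb]]] := oK_euclid oa ob b0.
have [i bi] := fnormK_oK ob; have [j rj] := fnormK_oK or.
move: rb; rewrite bi rj !ltr_nat ltnS => ji ik.
have [] := IH b r ob or; first by rewrite rj ltr_nat (leq_trans ji).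
move=> d [x [y [b' [r' [ox oy ob' or' [eb er ed]]]]]].
exists d, y, (x - y * q), (b' * q + r'), b'; split; [oK_closed .. | ].
split=> //; first by rewrite e {1}eb er; ring.
by rewrite {1}ed e; ring.
Qed.

(* Writing [N] for the norm of [d], one has [N = d d'] and
   [5 b = sqrt 5 (d - d')], and [N] is coprime to [b] and to [5]. *)
Lemma coprime_conjK (a b : int) : coprimez a b ->
  ~~ (5 %| a ^+ 2 + a * b - b ^+ 2)%Z ->
  let d : K := a%:~R + b%:~R * tau in
  exists x y, [/\ oK x, oK y & x * d + y * conjK d = 1].
Proof.
move=> ab + d; have /coprimezP[[s t] /= st] := ab; set N := _ - _ => N5.
have /coprimezP[[k l] /= kl] : coprimez N 5.
  by rewrite coprimez_sym /coprimez /gcdz eqz_nat -/(coprime _ _) prime_coprime.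
(* Substituting [a^2 = N - a b + b^2] in [(s a + t b)^2 = 1] gives [s^2 N + b c = 1], which is then
   multiplied by [k N + 5 l = 1]. *)
pose c := 2 * s * t * a + t ^+ 2 * b - s ^+ 2 * a + s ^+ 2 * b.
have e : (s ^+ 2 * (k * N + 5 * l) + b * c * k) * N + (5 * b) * (l * c) = 1.
  have : (s * a + t * b) ^+ 2 * (k * N + l * 5) = 1 by rewrite st kl; ring.
  by apply: etrans; rewrite /c /N; ring.
move: e; set x := (X in X * N); set y := l * c => /(congr1 (intr : int -> K)).
rewrite !(intrD, intrM) => e.
have dc : conjK d = a%:~R + b%:~R * (1 - tau).
  by rewrite rmorphD rmorphM !rmorph_int /= conj_tau.
have t2 := tau_sqr.
exists (x%:~R * conjK d + y%:~R * (2 * tau - 1)), (- (y%:~R * (2 * tau - 1))).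
have od : oK d by apply/oKP; exists a, b.
split; [oK_closed .. | ].
by apply: etrans e; rewrite /N !(intrD, intrM, intrN, rmorphXn) dc /d /=; ring: t2.
Qed.

(** [(2 a + b)^2 = 4 (a^2 + a b - b^2) + 5 b^2], and 5 is prime. *)
Lemma dvdz5_normK (a b : int) : (5 %| a ^+ 2 + a * b - b ^+ 2)%Z ->
  (5 %| 2 * a + b)%Z.
Proof.
move=> /dvdzP[k e]; suff : (5 %| (2 * a + b) ^+ 2)%Z.
  by rewrite !dvdzE abszX Euclid_dvdX // => /andP[].
apply/dvdzP; exists (4 * k + b ^+ 2).
have -> : (4 * k + b ^+ 2) * 5 = 4 * (k * 5) + b ^+ 2 * 5 by ring.
by rewrite -e; ring.
Qed.

(* Strip from [x] its rational content and, if it remains, a factor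
   [sqrt 5 = 2 tau - 1]. *)
Lemma oK_conj_factor (x : K) : oK x -> x != 0 ->
  exists (u : int) d, [/\ oK d, x ^+ 2 = u%:~R * d ^+ 2
    & exists r s, [/\ oK r, oK s & r * d + s * conjK d = 1]].
Proof.
move=> /oKP[a [b ->]] x0.
pose g := gcdz a b.
have g0 : g != 0.
  apply: contra x0; rewrite gcdz_eq0 => /andP[/eqP-> /eqP->].
  by rewrite mul0r addr0.
have /dvdzP[a1 ea] := dvdz_gcdl a b; have /dvdzP[b1 eb] := dvdz_gcdr a b.
have [s [t]] := Bezoutz a b.
move: ea eb; rewrite -/g; move: g g0 => {}g g0 ea eb st; subst a b.
have st1 : s * a1 + t * b1 = 1.
  by apply: (mulIf g0); rewrite mul1r -{2}st; ring.
have cop : coprimez a1 b1 by apply/coprimezP; exists (s, t).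
have [N5|N5] := boolP (5 %| a1 ^+ 2 + a1 * b1 - b1 ^+ 2)%Z; last first.
  exists (g ^+ 2), (a1%:~R + b1%:~R * tau); split.
  - by apply/oKP; exists a1, b1.
  - by rewrite !intrM; ring.
  - exact: coprime_conjK.
have /dvdzP[b2 eb2] := dvdz5_normK N5.
(* [a2 + b2 tau] is the quotient of [a1 + b1 tau] by [2 tau - 1], whose square 5 goes into [u]. *)
pose a2 := 2 * b2 - a1.
have ea1 : a1 = 2 * b2 - a2 by rewrite /a2; ring.
have eb1 : b1 = 2 * a2 + b2.
  have -> : b1 = b2 * 5 - 2 * a1 by rewrite -eb2; ring.
  by rewrite /a2; ring.
exists (5 * g ^+ 2), (a2%:~R + b2%:~R * tau); split.
- by apply/oKP; exists a2, b2.
- rewrite ea1 eb1; have t2 := tau_sqr.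
  by rewrite !(intrM, intrD, intrN); ring: t2.
- apply: coprime_conjK.
    apply/coprimezP; exists (2 * t - s, 2 * s + t) => /=.
    by apply: etrans st1; rewrite ea1 eb1; ring.
  (* If 5 still divided the norm, it would divide both [b1] and [a1], which are coprime. *)
  apply/negP => /dvdz5_normK; rewrite -eb1 => /dvdzP[k ek].
  have : (s * (2 * k - a2) + t * k) * 5 = 1.
    apply: etrans st1; rewrite mulrDl -[t * k * 5]mulrA -ek; congr (_ + _).
    rewrite ea1; have -> : b2 = k * 5 - 2 * a2 by rewrite -ek eb1; ring.
    by ring.
  lia.
Qed.

(** Conjugation fixes [m = (x + n)^2 / x], so [x = U d^2] with [U] rational, and coprimality of [d]
    and [d'] makes [U] integral. The case [x = - n] is excluded because [m] vanishes there. *)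
Lemma oK_square_norm (x : K) (n : nat) :
  oK x -> x * conjK x = n%:R ^+ 2 -> x + n%:R != 0 ->
  exists (u : int) d, [/\ oK d, x = u%:~R * d ^+ 2
    & exists r s, [/\ oK r, oK s & r * d + s * conjK d = 1]].
Proof.
move=> ox xn x0.
have [|w [d [od e [r [s [or os rs]]]]]] := oK_conj_factor (x := x + n%:R) _ x0.
  by oK_closed.
pose m := 2 * n%:R + x + conjK x.
have xm : x * m = (x + n%:R) ^+ 2.
  by rewrite /m !mulrDr xn; ring.
have m0 : m != 0.
  apply/eqP => m0; move/eqP: xm; rewrite m0 mulr0 eq_sym expf_eq0 /=.
  by rewrite (negPf x0).
pose U := w%:~R / m.
have xU : x = U * d ^+ 2 by rewrite /U mulrAC -e -xm mulfK.
have cU : conjK U = U.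
  rewrite /U rmorphM fmorphV rmorph_int; congr (_ / _).
  by rewrite /m !rmorphD rmorphM !rmorph_nat /= conjKK; ring.
have xU' : conjK x = U * conjK d ^+ 2 by rewrite xU rmorphM rmorphXn /= cU.
have oU : oK U.
  (* Every term of the expansion of [(r d + s d')^3 = 1] contains [d^2] or [d'^2], so [U] is a
     combination of [x] and [x']. *)
  have -> : U = x * (r ^+ 2 * (r * d + 3 * s * conjK d)) +
      conjK x * (s ^+ 2 * (3 * r * d + s * conjK d)).
    rewrite xU' [in X in X + _]xU.
    transitivity (U * (r * d + s * conjK d) ^+ 3).
      by rewrite rs expr1n mulr1.
    by ring.
  by oK_closed.
have [u eu] := oK_conj_fixed oU cU.
by exists u, d; split; [ | rewrite xU eu | exists r, s].
Qed.

(** * Icosians *)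

Section QuatTheory.
Variable F : comNzRingType.
Implicit Types (p q : quat F) (a : F).

Lemma quat_eq p q : qre p = qre q -> qi p = qi q -> qj p = qj q -> qk p = qk q ->
  p = q.
Proof. by case: p q => [????] [????] /= -> -> -> ->. Qed.

Lemma qscaleAl a p q : (a *: p) * q = a *: (p * q).
Proof. by congr Quat => /=; ring. Qed.

Lemma qscaleAr a p q : p * (a *: q) = a *: (p * q).
Proof. by congr Quat => /=; ring. Qed.

Lemma mulq_qconj q : q * qconj q = nr q *: (1 : quat F).
Proof. by congr Quat; rewrite /nr /=; ring. Qed.

Lemma mul_qconjq q : qconj q * q = nr q *: (1 : quat F).
Proof. by congr Quat; rewrite /nr /=; ring. Qed.

Lemma nrM p q : nr (p * q) = nr p * nr q.
Proof. by rewrite /nr /=; ring. Qed.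

End QuatTheory.

Implicit Types (p q z : HK) (a : K).

Lemma twistD p q : twist (p + q) = twist p + twist q.
Proof. by congr Quat; rewrite /= rmorphD. Qed.

Lemma twistZ a q : twist (a *: q) = conjK a *: twist q.
Proof. by congr Quat; rewrite /= rmorphM. Qed.

(** The exchange of [j] and [k] reverses products: it turns [i j = k] into [k i = j]. *)
Lemma twistM p q : twist (p * q) = twist q * twist p.
Proof. by congr Quat; rewrite /= !(rmorphD, rmorphN, rmorphM) /=; ring. Qed.

Lemma twistK : involutive twist.
Proof. by case=> a b c d; rewrite /twist /= !conjKK. Qed.

Lemma twist_qconj q : twist (qconj q) = qconj (twist q).
Proof. by congr Quat; rewrite /= rmorphN. Qed.

Lemma nr_twist q : nr (twist q) = conjK (nr q).
Proof. by rewrite /nr /= !(rmorphD, rmorphXn) /= addrAC -!addrA. Qed.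

(** Coordinates on the four generators of [icosian], with the factor 1/2 taken out. *)
Definition icosian_comb (c1 c2 c3 c4 : K) : HK :=
  2^-1 *: Quat (2 * c1 + c3 + (1 - tau) * c4) (2 * c2 + c3 + tau * c4) c3 (c3 + c4).

Lemma icosianP q : icosian q <->
  exists c1 c2 c3 c4, [/\ oK c1, oK c2, oK c3, oK c4 & q = icosian_comb c1 c2 c3 c4].
Proof.
have n2 := two_neq0.
split=> [[c oc <-]|[c1 [c2 [c3 [c4 [o1 o2 o3 o4 ->]]]]]].
  exists (c 0), (c 1), (c 2), (c 3); split; try exact: oc.
  by rewrite !big_ord_recr big_ord0; congr Quat => /=; field.
(* [lattice_span] asks for integral coefficients at every index; beyond 3 the default 0 provides
   them. *)
exists (nth 0 [:: c1; c2; c3; c4]).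
  by move=> [|[|[|[|i]]]] //=; rewrite nth_nil; apply: (oK_nat 0).
by rewrite !big_ord_recr big_ord0; congr Quat => /=; field.
Qed.

Lemma icosian_combP c1 c2 c3 c4 : oK c1 -> oK c2 -> oK c3 -> oK c4 ->
  icosian (icosian_comb c1 c2 c3 c4).
Proof. by move=> o1 o2 o3 o4; apply/icosianP; exists c1, c2, c3, c4. Qed.

Lemma icosianD p q : icosian p -> icosian q -> icosian (p + q).
Proof.
move=> /icosianP[c1 [c2 [c3 [c4 [o1 o2 o3 o4 ->]]]]].
move=> /icosianP[d1 [d2 [d3 [d4 [p1 p2 p3 p4 ->]]]]].
apply/icosianP; exists (c1 + d1), (c2 + d2), (c3 + d3), (c4 + d4).
by split; [oK_closed .. | ]; congr Quat => /=; ring.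
Qed.

Lemma icosianZ a q : oK a -> icosian q -> icosian (a *: q).
Proof.
move=> oa /icosianP[c1 [c2 [c3 [c4 [o1 o2 o3 o4 ->]]]]].
apply/icosianP; exists (a * c1), (a * c2), (a * c3), (a * c4).
by split; [oK_closed .. | ]; congr Quat => /=; ring.
Qed.

Lemma icosian_conj q : icosian q -> icosian (qconj q).
Proof.
have n2 := two_neq0; have t2 := tau_sqr.
move=> /icosianP[c1 [c2 [c3 [c4 [o1 o2 o3 o4 ->]]]]].
(* [qconj q] is [2 Re q - q], where [2 Re q = 2 c1 + c3 + (1 - tau) c4]. *)
apply/icosianP; exists (c1 + c3 + (1 - tau) * c4), (- c2), (- c3), (- c4).
by split; [oK_closed .. | ]; congr Quat => /=; field: t2.
Qed.

(** The twist fixes the first three basis vectors and sends the fourth to the third minus the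
    fourth. *)
Lemma twist_icosian_comb c1 c2 c3 c4 : twist (icosian_comb c1 c2 c3 c4) =
  icosian_comb (conjK c1) (conjK c2) (conjK c3 + conjK c4) (- conjK c4).
Proof.
have k2 : conjK 2^-1 = 2^-1 by rewrite fmorphV rmorph_nat.
rewrite /icosian_comb twistZ k2; congr (_ *: _); apply: quat_eq; rewrite /=.
- rewrite 2!rmorphD 2!rmorphM rmorphB rmorph1 rmorph_nat /= conj_tau.
  by ring.
- rewrite 2!rmorphD 2!rmorphM rmorph_nat /= conj_tau.
  by ring.
- by rewrite rmorphD.
- by ring.
Qed.

Lemma icosian_twist q : icosian q -> icosian (twist q).
Proof.
move=> /icosianP[c1 [c2 [c3 [c4 [o1 o2 o3 o4 ->]]]]].
by rewrite twist_icosian_comb; apply: icosian_combP; oK_closed.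
Qed.

(* To be used instead of [congr], which gets lost in conversion checks in [K]. *)
Lemma icosian_comb_eq c1 c2 c3 c4 d1 d2 d3 d4 :
  c1 = d1 -> c2 = d2 -> c3 = d3 -> c4 = d4 ->
  icosian_comb c1 c2 c3 c4 = icosian_comb d1 d2 d3 d4.
Proof. by move=> -> -> -> ->. Qed.

Lemma icosian_comb_inj c1 c2 c3 c4 d1 d2 d3 d4 :
  icosian_comb c1 c2 c3 c4 = icosian_comb d1 d2 d3 d4 ->
  [/\ c1 = d1, c2 = d2, c3 = d3 & c4 = d4].
Proof.
have n2 := two_neq0.
have h2 : injective ( *%R 2^-1 : K -> K) by apply: mulfI; rewrite invr_eq0.
move=> e; have /= /h2 e1 := congr1 (@qre K) e; have /= /h2 e2 := congr1 (@qi K) e.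
have /= /h2 e3 := congr1 (@qj K) e; have /= /h2 e4 := congr1 (@qk K) e.
move: e1 e2 e4; rewrite e3 => e1 e2 /addrI e4; move: e1 e2; rewrite e4.
by move=> /addIr/addIr/(mulfI n2) -> /addIr/addIr/(mulfI n2) ->.
Qed.

(* The coefficients are the structure constants of the icosian basis. *)
Lemma icosianM p q : icosian p -> icosian q -> icosian (p * q).
Proof.
have n2 := two_neq0; have t2 := tau_sqr.
move=> /icosianP[c1 [c2 [c3 [c4 [o1 o2 o3 o4 ->]]]]].
move=> /icosianP[d1 [d2 [d3 [d4 [p1 p2 p3 p4 ->]]]]].
apply/icosianP.
exists (c1 * d1 - c2 * d2 + (tau - 1) * c2 * d3 - tau * c3 * d2 - c3 * d3
  - c3 * d4 - tau * c4 * d2 - c4 * d4),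
 (c1 * d2 + c2 * d1 + (1 - tau) * c2 * (d3 + d4) + tau * c3 * d2 + c3 * d4
  - c4 * d3),
 (c1 * d3 - c2 * d3 - c2 * d4 + c3 * d1 + c3 * d2 + c3 * d3 + c4 * d2
  + (1 - tau) * c4 * d3),
 (c1 * d4 + 2 * c2 * d3 + c2 * d4 - 2 * c3 * d2 + (1 - tau) * c3 * d4
  + c4 * d1 - c4 * d2 + tau * c4 * d3 + (1 - tau) * c4 * d4).
by split; [oK_closed .. | ]; apply: quat_eq => /=; field: t2.
Qed.

Lemma half_notin_oK : ~ oK 2^-1.
Proof.
move=> /oK_conj_fixed[|m]; first by rewrite fmorphV rmorph_nat.
move=> /(congr1 ( *%R 2)); rewrite divff ?two_neq0 // -[2]/(2%:~R) -intrM.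
by rewrite -[1]/(1%:~R) => /intK_inj; lia.
Qed.

(* Unimodularity of the trace form: the coefficients of the witness come from
   the inverse Gram matrix of the icosian basis. *)
Lemma primitive_trace1 q : primitive q ->
  exists2 c, icosian c & q * c + qconj c * qconj q = 1.
Proof.
have n2 := two_neq0; have t2 := tau_sqr.
move=> [/icosianP[c1 [c2 [c3 [c4 [o1 o2 o3 o4 ->]]]]] prim].
(* Iterated Bezout relations yield a gcd [d] of the four coordinates. Primitivity makes [d] a unit,
   so the coordinates generate the unit ideal. *)
have [d1 [x1 [x2 [e1 [e2 [ox1 ox2 oe1 oe2 [h1 h2 hd1]]]]]]] := oK_bezout o1 o2.
have [d2 [x3 [x4 [e3 [e4 [ox3 ox4 oe3 oe4 [h3 h4 hd2]]]]]]] := oK_bezout o3 o4.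
have od1 : oK d1 by rewrite hd1; oK_closed.
have od2 : oK d2 by rewrite hd2; oK_closed.
have [d [y1 [y2 [f1 [f2 [oy1 oy2 of1 of2 [k1 k2 hd]]]]]]] := oK_bezout od1 od2.
have d0 : d != 0.
  apply/eqP => d0; move: prim; rewrite h1 h2 h3 h4 k1 k2 d0.
  move=> /(_ 2^-1) h; apply: half_notin_oK; apply: h.
  rewrite !mul0r; apply/icosianP; exists 0, 0, 0, 0.
  by split; [oK_closed .. | congr Quat => /=; field].
have dV : oK d^-1.
  apply: prim; apply/icosianP; exists (f1 * e1), (f1 * e2), (f2 * e3), (f2 * e4).
  split; [oK_closed .. | ].
  by rewrite h1 h2 h3 h4 k1 k2; congr Quat => /=; field; rewrite ?d0 ?n2.
have [g1 [g2 [g3 [g4 [og1 og2 og3 og4 hz]]]]] : exists g1 g2 g3 g4,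
  [/\ oK g1, oK g2, oK g3, oK g4 & g1 * c1 + g2 * c2 + g3 * c3 + g4 * c4 = 1].
  exists (d^-1 * y1 * x1), (d^-1 * y1 * x2), (d^-1 * y2 * x3), (d^-1 * y2 * x4).
  split; [oK_closed .. | ].
  by apply: etrans (mulVf d0); rewrite [X in _ = _ * X]hd hd1 hd2; ring.
exists (icosian_comb (- g1 + g2 + tau * g3 + (1 - 2 * tau) * g4)
  (g1 - 2 * g2 + (1 - tau) * g3 + (2 * tau - 1) * g4)
  (tau * g1 + (1 - tau) * g2 - 2 * g3 + 2 * g4)
  ((1 - 2 * tau) * g1 + (2 * tau - 1) * g2 + 2 * g3 - 4 * g4)).
  by apply: icosian_combP; oK_closed.
apply: quat_eq => /=; first (apply: etrans hz); by field: t2.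
Qed.

(** * The lattice L inside the icosians *)

Lemma conjK_int (m : int) : conjK m%:~R = m%:~R.
Proof. exact: rmorph_int. Qed.

Lemma latLP z : latL z <-> icosian z /\ twist z = z.
Proof.
have n2 := two_neq0; have t2 := tau_sqr.
(* Icosian coordinates of a combination of the generators of [latL]. *)
pose comb (a b c e : K) : HK :=
  icosian_comb (a - b - e) (2 * e - c) (b - e + e * tau) (e * (1 - 2 * tau)).
have combE (c : nat -> K) : comb (c 0%N) (c 1%N) (c 2%N) (c 3%N) =
    \sum_(i < 4) c i *: [:: Quat 1 0 0 0; 2^-1 *: Quat (-1) 1 1 1;
      Quat 0 (-1) 0 0; 2^-1 *: Quat 0 1 (tau - 1) (- tau)]`_i.
  rewrite !big_ord_recr big_ord0 /= /comb.
  by apply: quat_eq => /=; field: t2.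
split.
  case=> c hc <-; rewrite -combE.
  have [k0 _ e0] := hc 0%N; have [k1 _ e1] := hc 1%N.
  have [k2 _ e2] := hc 2%N; have [k3 _ e3] := hc 3%N.
  rewrite -e0 -e1 -e2 -e3.
  split; first by apply: icosian_combP; oK_closed.
  rewrite twist_icosian_comb.
  have conjc3 : conjK (k3%:~R * (1 - 2 * tau)) = - (k3%:~R * (1 - 2 * tau)).
    rewrite rmorphM rmorphB rmorph1 rmorphM rmorph_nat /= conj_tau conjK_int.
    by ring.
  apply: icosian_comb_eq.
  - by rewrite !rmorphB /= !conjK_int.
  - by rewrite !rmorphB rmorphM rmorph_nat /= !conjK_int.
  - rewrite conjc3 rmorphD rmorphB rmorphM /= !conjK_int conj_tau.
    by ring.
  - by rewrite conjc3; ring.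
case=> /icosianP[c1 [c2 [c3 [c4 [o1 o2 o3 o4 ->]]]]].
rewrite twist_icosian_comb => /icosian_comb_inj[].
(* Invariance makes [c1], [c2] rational integers and forces [c4 = c3' - c3]. Four integers remain,
   and [k] is found by solving for the arguments of [comb]. *)
move=> /(oK_conj_fixed o1)[m1 ->] /(oK_conj_fixed o2)[m2 ->] e3 e4.
have /oKP[m3 [n3 c3E]] := o3.
have c4E : c4 = n3%:~R * (1 - 2 * tau).
  have -> : c4 = conjK c3 - c3 by rewrite -e4 -{2}e3; ring.
  by rewrite c3E rmorphD rmorphM /= !conjK_int conj_tau; ring.
pose k := nth 0 [:: m1 + m3 + 2 * n3; m3 + n3; 2 * n3 - m2; n3].
exists (fun i => (k i)%:~R); first by move=> i; exists (k i).
apply: etrans (esym (combE (fun i => (k i)%:~R))) _.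
rewrite /comb c4E c3E /k /= !(intrD, intrM, intrN).
by apply: icosian_comb_eq; ring.
Qed.

(** * Splitting of a coincidence point *)

Ltac icosian_closed := repeat match goal with
  | |- icosian (_ + _) => apply: icosianD
  | |- icosian (_ * _) => apply: icosianM
  | |- icosian (_ *: _) => apply: icosianZ
  | |- icosian (qconj _) => apply: icosian_conj
  | |- icosian (twist _) => apply: icosian_twist
  | |- icosian _ => assumption
  | |- oK _ => progress oK_closed
  end.

(** In the application [p = q~], [c' = c~] and [d'] is the conjugate of [d]. Independent letters
    make the argument symmetric under reversal of products. *)
Lemma icosian_decomp q p y z c c' (u d d' a b : K) :
  [/\ icosian q, icosian p, icosian y & icosian z] ->
  icosian c -> q * c + qconj c * qconj q = 1 ->
  icosian c' -> c' * p + qconj p * qconj c' = 1 ->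
  [/\ oK u, oK d, oK d', oK a & oK b] ->
  u * d * d' != 0 -> a * d + b * d' = 1 ->
  nr q = u * d ^+ 2 -> nr p = u * d' ^+ 2 ->
  q * y * p = (u * d * d') *: z ->
  exists s t, [/\ icosian s, icosian t & z = d' *: (q * s) + d *: (t * p)].
Proof.
move=> [iq ip iy iz] ic c1 ic' c'1 [ou od od' oa ob] udd ab nq np e.
have cancel (k : K) (x x' : HK) : k != 0 -> k *: x = k *: x' -> x = x'.
  by move=> k0 /(congr1 ( *:%R k^-1)); rewrite !scalerA mulVf // !scale1r.
move: (udd); rewrite !mulf_eq0 !negb_or => /andP[/andP[u0 d0] d'0].
have yp : d *: (y * p) = d' *: (qconj q * z).
  apply: (cancel (u * d)); first by rewrite mulf_neq0.
  rewrite scalerA [in RHS]scalerA -[in RHS]qscaleAr -e !mulrA mul_qconjq nq.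
  by rewrite !qscaleAl mul1r; congr (_ *: _); ring.
have qy : d' *: (q * y) = d *: (z * qconj p).
  apply: (cancel (u * d')); first by rewrite mulf_neq0.
  have -> : (u * d') *: (d *: (z * qconj p)) = q * y * p * qconj p.
    by rewrite e qscaleAl scalerA; congr (_ *: _); ring.
  by rewrite -mulrA mulq_qconj np qscaleAr mulr1 scalerA; congr (_ *: _); ring.
(* By coprimality of [d] and [d'], the relation [d Y = d' X] makes [X], [Y] the multiples by [d],
   [d'] of one element, here integral. *)
have common (X Y : HK) : d *: Y = d' *: X ->
    X = d *: (a *: X + b *: Y) /\ Y = d' *: (a *: X + b *: Y).
  move=> XY; rewrite !scalerDr !scalerA [d * b]mulrC [d' * a]mulrC -!scalerA XY.
  rewrite -[in X in _ /\ X]XY !scalerA -!scalerDl [d * a]mulrC [d' * b]mulrC ab.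
  by rewrite !scale1r.
set w := a *: (qconj q * z) + b *: (y * p).
set v := a *: (q * y) + b *: (z * qconj p).
have [qzw ypw] : qconj q * z = d *: w /\ y * p = d' *: w by apply: common.
have [qyv zpv] : q * y = d *: v /\ z * qconj p = d' *: v by apply: common.
have wp : w * qconj p = (u * d') *: y.
  apply: (cancel d') => //; rewrite -qscaleAl -ypw -mulrA mulq_qconj np.
  by rewrite qscaleAr mulr1 scalerA; congr (_ *: _); ring.
have qv : qconj q * v = (u * d) *: y.
  apply: (cancel d) => //; rewrite -qscaleAr -qyv mulrA mul_qconjq nq.
  by rewrite qscaleAl mul1r scalerA; congr (_ *: _); ring.
set Y := qconj c * y * qconj c'.
have iw : icosian w by rewrite /w; icosian_closed.
have iv : icosian v by rewrite /v; icosian_closed.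
have iY : icosian Y by rewrite /Y; icosian_closed.
clearbody w v.
(* Inserting [c' p + conj p conj c' = 1] to the right of [w] gives [t1 p = d' conj c w], because
   [u d'^2 Y = Y conj p p]. The mirror image gives [q s2 = d v conj c']. *)
pose t1 := d' *: (qconj c * w * c') + Y * qconj p.
pose s2 := d *: (c * v * qconj c') + qconj q * Y.
have z1 : d' *: z = d' *: (q * (c * z)) + d *: (t1 * p).
  have -> : t1 * p = d' *: (qconj c * w).
    rewrite mulrDl qscaleAl -[Y * _ * _]mulrA mul_qconjq np qscaleAr mulr1.
    rewrite -[in RHS](mulr1 (qconj c * w)) -c'1 mulrDr scalerDr !mulrA.
    rewrite -[qconj c * w * qconj p]mulrA wp qscaleAr qscaleAl scalerA.
    by congr (_ + _ *: _); ring.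
  rewrite scalerA [d * _]mulrC -scalerA -[d *: _]qscaleAr -qzw !mulrA.
  by rewrite -scalerDr -mulrDl c1 mul1r.
have z2 : d *: z = d' *: (q * s2) + d *: (z * c' * p).
  have -> : q * s2 = d *: (v * qconj c').
    rewrite mulrDr qscaleAr [q * (qconj q * Y)]mulrA mulq_qconj nq qscaleAl mul1r.
    rewrite -[in RHS](mul1r (v * qconj c')) -c1 mulrDl scalerDr !mulrA.
    rewrite -[qconj c * qconj q * v]mulrA qv qscaleAr qscaleAl scalerA.
    by congr (_ + _ *: _); ring.
  rewrite scalerA [d' * d]mulrC -scalerA -[d' *: _]qscaleAl -zpv -!mulrA.
  by rewrite -scalerDr -mulrDr addrC c'1 mulr1.
have is2 : icosian s2 by rewrite /s2; icosian_closed.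
have it1 : icosian t1 by rewrite /t1; icosian_closed.
clearbody s2 t1.
(* [z = a (d z) + b (d' z)], with [z2] and [z1] substituted. *)
exists (a *: s2 + b *: (c * z)), (a *: (z * c') + b *: t1); split.
- by icosian_closed.
- by icosian_closed.
- rewrite -[LHS]scale1r -ab scalerDl -!scalerA z1 z2.
  rewrite mulrDr mulrDl !qscaleAr !qscaleAl !scalerDr !scalerA.
  by rewrite [a * d']mulrC [a * d]mulrC [b * d']mulrC [b * d]mulrC addrACA.
Qed.

(** * Lengths, lcm and extension *)

Lemma oK_nr q : icosian q -> oK (nr q).
Proof.
have n2 := two_neq0; have t2 := tau_sqr.
move=> /icosianP[c1 [c2 [c3 [c4 [o1 o2 o3 o4 ->]]]]].
have -> : nr (icosian_comb c1 c2 c3 c4) =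
    c1 ^+ 2 + c2 ^+ 2 + c3 ^+ 2 + c4 ^+ 2 + c1 * c3 + (1 - tau) * (c1 * c4)
    + c2 * c3 + tau * (c2 * c4) + c3 * c4.
  by rewrite /nr /=; field: t2.
by oK_closed.
Qed.

Section RealEmbedding.
Variable R : realType.

Lemma real_of_K_is_zmod_morphism : zmod_morphism (real_of_K R).
Proof.
by move=> [a b] [c d]; rewrite /real_of_K /= !rmorphB /=; ring.
Qed.

Lemma real_of_K_is_monoid_morphism : monoid_morphism (real_of_K R).
Proof.
split=> [|[a b] [c d]]; rewrite /real_of_K /= ?rmorph1 ?rmorph0 ?mul0r ?addr0 //.
have s5 : Num.sqrt 5 ^+ 2 = 5 :> R by rewrite sqr_sqrtr.
by rewrite !(rmorphD, rmorphM, rmorph1) /=; ring: s5.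
Qed.

HB.instance Definition _ := GRing.isZmodMorphism.Build K R (real_of_K R)
  real_of_K_is_zmod_morphism.
HB.instance Definition _ := GRing.isMonoidMorphism.Build K R (real_of_K R)
  real_of_K_is_monoid_morphism.

Lemma quat_of_KM p q : quat_of_K R (p * q) = quat_of_K R p * quat_of_K R q.
Proof. by apply: quat_eq; rewrite /= !(rmorphD, rmorphN, rmorphM). Qed.

Lemma quat_of_KZ a q : quat_of_K R (a *: q) = real_of_K R a *: quat_of_K R q.
Proof. by apply: quat_eq; rewrite /= rmorphM. Qed.

Lemma quat_of_K_inj : injective (quat_of_K R).
Proof.
have inj : injective (real_of_K R) by exact: fmorph_inj.
by move=> [a b c d] [a' b' c' d'] [] /inj -> /inj -> /inj -> /inj ->.
Qed.

Lemma nr_quat_of_K q : nr (quat_of_K R q) = real_of_K R (nr q).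
Proof. by rewrite /nr /= !rmorphD !rmorphXn. Qed.

Lemma real_nr_ge0 q : 0 <= real_of_K R (nr q).
Proof. by rewrite -nr_quat_of_K /nr !addr_ge0 ?sqr_ge0. Qed.

Lemma admissible_nr q (n : nat) : twist_len R q = n%:R ->
  nr q * conjK (nr q) = n%:R ^+ 2.
Proof.
move=> qn; apply: (fmorph_inj (real_of_K R)).
rewrite rmorphXn rmorph_nat /= -qn /twist_len /qlen sqr_sqrtr.
  by rewrite nr_quat_of_K nrM nr_twist.
by rewrite nr_quat_of_K real_nr_ge0.
Qed.

(** The real root of [d^2] is the absolute value of [d], attained in [K] by [d] or [- d]; hence
    [xget] does not return its default. *)
Lemma alphaE q d : (lcm_nr q)%:R / nr q = d ^+ 2 ->
  exists e : bool, alpha R q = (-1) ^+ e * d.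
Proof.
rewrite /alpha => ->; rewrite rmorphXn sqrtr_sqr /=; set P := [set _ | _].
have : P (xget 0 P).
  apply: (@xgetPex _ 0 P); exists ((-1) ^+ (real_of_K R d < 0)%R * d).
  by rewrite /P /= rmorphM rmorph_sign /= -normrEsign.
rewrite {1}/P /= => /(congr1 (fun x => x ^+ 2)).
rewrite real_normK ?num_real // -!rmorphXn => /fmorph_inj /eqP.
rewrite eqf_sqr => /orP[] /eqP ->; first by exists false; rewrite mul1r.
by exists true; rewrite mulN1r.
Qed.

End RealEmbedding.

(** Positive integers generating the same ideal divide each other: their quotient is integral and
    fixed by conjugation, hence a rational integer. *)
Lemma lcm_nrE q (l : nat) : (0 < l)%N ->
  principal l%:R = principal (nr q) `&` principal (conjK (nr q)) ->
  lcm_nr q = l.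
Proof.
move=> l0 hl; rewrite /lcm_nr; set P := [set _ | _].
have [m0 hm] : P (xget 0%N P) by apply: (@xgetPex _ 0%N P); exists l.
move: (xget 0%N P) m0 hm => m m0 hm.
have dvd (a b : nat) : (0 < a)%N -> principal (a%:R : K) = principal b%:R ->
    (b %| a)%N.
  move=> a0 ab; have : principal (b%:R : K) a%:R.
    by rewrite -ab; exists 1; rewrite ?mulr1 //; apply: (oK_nat 1).
  case=> x ox bx.
  have [|k ek] := oK_conj_fixed ox.
    have b0 : b%:R != 0 :> K.
      apply: contraTneq a0 => b0; move: bx; rewrite b0 mul0r.
      by move=> /(@natK_inj 0 a) <-.
    apply: (mulfI b0); rewrite bx -[in LHS](rmorph_nat conjK b) -rmorphM /= bx.
    by rewrite rmorph_nat.
  have : (b%:Z * k) = a%:Z.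
    by apply: intK_inj; rewrite intrM -ek -!pmulrn.
  by move=> /(congr1 absz); rewrite abszM !absz_nat => <-; apply: dvdn_mulr.
by apply/eqP; rewrite eqn_dvd !dvd ?hm ?hl.
Qed.

Lemma principal_lcm (u : K) d r s : oK d -> oK r -> oK s -> conjK u = u -> u != 0 ->
  d != 0 -> r * d + s * conjK d = 1 ->
  principal (u * d ^+ 2 * conjK d ^+ 2) =
    principal (u * d ^+ 2) `&` principal (conjK (u * d ^+ 2)).
Proof.
move=> od or os cu u0 d0 rs; rewrite rmorphM rmorphXn /= cu.
apply/seteqP; split=> x /=.
  case=> y oy <-; split.
    by exists (conjK d ^+ 2 * y); [oK_closed | ring].
  by exists (d ^+ 2 * y); [oK_closed | ring].
case=> -[y oy yx] [y' oy' y'x].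
(* The cube of the Bezout relation again shows [d^2] and [d'^2] comaximal. With [d^2 y = d'^2 y'] it
   follows that [y = d'^2 (A y' + B y)]. *)
pose A := r ^+ 2 * (r * d + 3 * s * conjK d).
pose B := s ^+ 2 * (3 * r * d + s * conjK d).
have AB : A * d ^+ 2 + B * conjK d ^+ 2 = 1.
  transitivity ((r * d + s * conjK d) ^+ 3); last by rewrite rs expr1n.
  by rewrite /A /B; ring.
have dy : d ^+ 2 * y = conjK d ^+ 2 * y'.
  by apply: (mulfI u0); rewrite mulrA yx mulrA y'x.
exists (A * y' + B * y); first by rewrite /A /B; oK_closed.
rewrite -yx -[in RHS](mulr1 y) -AB /=.
transitivity (u * d ^+ 2 * (A * (conjK d ^+ 2 * y') + B * conjK d ^+ 2 * y)).
  by ring.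
by rewrite -dy; ring.
Qed.

(** The signs [e], [f] appear because [alpha_q] and the length are known only through their squares
    [d'^2] and [k^2]. *)
Lemma admissible_factor (R : realType) q : admissible R q ->
  exists (u : int) d (e f : bool), let k := u%:~R * d * conjK d in
  [/\ oK d, nr q = u%:~R * d ^+ 2, k != 0, alpha R q = (-1) ^+ e * conjK d
    & twist_len R q = real_of_K R ((-1) ^+ f * k)]
  /\ exists r s, [/\ oK r, oK s & r * d + s * conjK d = 1].
Proof.
move=> [iq [n n0 qn]]; have nn := admissible_nr qn.
have nK0 : n%:R != 0 :> K.
  by apply: contraTneq n0 => /(@natK_inj n 0) ->.
have x0 : nr q + n%:R != 0.
  rewrite -(fmorph_eq0 (real_of_K R)) rmorphD rmorph_nat /= gt_eqF //.
  by rewrite ltr_wpDl ?real_nr_ge0 ?ltr0n.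
have [u [d [od e rs]]] := oK_square_norm (oK_nr iq) nn x0.
have nu0 : nr q != 0.
  apply/eqP => nu0; move: nn; rewrite nu0 mul0r => /esym/eqP.
  by rewrite expf_eq0 (negPf nK0).
move: (nu0); rewrite e mulf_eq0 expf_eq0 /= negb_or => /andP[u0 d0].
have d'0 : conjK d != 0 by rewrite fmorph_eq0.
(* In the reals [nr q] is nonnegative and [d^2] is positive. *)
have ugt0 : 0 < u.
  have u0' : u != 0 by apply: contraNneq u0 => ->.
  rewrite lt_neqAle eq_sym u0' /= -(ler0z R).
  have := real_nr_ge0 R q; rewrite e rmorphM rmorph_int rmorphXn /=.
  rewrite pmulr_lge0 // exprn_even_gt0 //= fmorph_eq0 //.
have cu : conjK u%:~R = u%:~R by rewrite rmorph_int.
have [m em] : exists m : int, d * conjK d = m%:~R.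
  apply: oK_conj_fixed; first by oK_closed.
  by rewrite rmorphM /= conjKK mulrC.
have m0 : m != 0.
  by apply: contraNneq (mulf_neq0 d0 d'0) => m0; rewrite em m0.
(* The rational integer [m = d d'] may be negative; only its square enters the lcm. *)
pose l := (absz u * absz m ^ 2)%N.
have lE : l%:R = u%:~R * d ^+ 2 * conjK d ^+ 2 :> K.
  rewrite -mulrA -exprMn em -rmorphXn -intrM /= pmulrn; congr (_%:~R).
  by rewrite /l PoszM -abszX !gez0_abs ?sqr_ge0 // ltW.
have lq : lcm_nr q = l.
  apply: lcm_nrE; first by rewrite muln_gt0 expn_gt0 !absz_gt0 gt_eqF ?m0.
  have [r [s [or os h]]] := rs.
  by rewrite lE e; apply: (principal_lcm od or os).
have [ea aE] : exists ea : bool, alpha R q = (-1) ^+ ea * conjK d.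
  by apply: alphaE; rewrite lq lE e mulrAC mulfV ?mul1r // -e.
have [f nE] : exists f : bool, n%:R = (-1) ^+ f * (u%:~R * d * conjK d).
  have : n%:R ^+ 2 == (u%:~R * d * conjK d) ^+ 2.
    by rewrite -nn e rmorphM rmorphXn /= cu; apply/eqP; ring.
  rewrite eqf_sqr => /orP[] /eqP ->; first by exists false; rewrite mul1r.
  by exists true; rewrite mulN1r.
exists u, d, ea, f; split=> //; split=> //; first by rewrite !mulf_neq0.
by rewrite -nE rmorph_nat.
Qed.

(** * The two inclusions *)

Unset Implicit Arguments.

Theorem theorem2 (R : realType) (q : quat qsqrt5)
    (q_admissible : admissible R q) (q_primitive : primitive q) :
  csl R q = [set quat_of_K R z | z in latL_of (extension R q)].
Proof.
have [u [d [e [f /=]]]] := admissible_factor q_admissible.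
set k := u%:~R * d * conjK d.
move=> [[od nq k0 aE len] [r [s [or os rs]]]].
have iq : icosian q by case: q_primitive.
have np : nr (twist q) = u%:~R * conjK d ^+ 2.
  by rewrite nr_twist nq rmorphM rmorphXn rmorph_int.
have signK (b : bool) : (-1) ^+ b * (-1) ^+ b = 1 :> K by rewrite -expr2 sqrr_sign.
have oK_sign (b : bool) : oK ((-1) ^+ b) by case: b; rewrite ?expr1 ?expr0; oK_closed.
have k'0 : (-1) ^+ f * k != 0 by rewrite mulf_neq0 // signr_eq0.
(* Injectivity of the embedding brings the real equation back to [K], where the length is
   [(-1)^f k]. *)
have cslE y z : quat_of_K R z = (twist_len R q)^-1 *:
    (quat_of_K R q * quat_of_K R y * quat_of_K R (twist q)) <->
    ((-1) ^+ f * k) *: z = q * y * twist q.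
  rewrite len -fmorphV -!quat_of_KM -quat_of_KZ; split=> [/quat_of_K_inj ->|<-].
    by rewrite scalerA mulfV // scale1r.
  by rewrite scalerA mulVf // scale1r.
have etaE x : extension R q * x + twist x * twist (extension R q) =
    extension R q * x + twist (extension R q * x).
  by rewrite twistM.
apply/seteqP; split=> v.
  case=> -[z Lz <-{v}] [y Ly /esym/cslE zy].
  exists z => //.
  have [iz tz] := (latLP z).1 Lz; have [iy _] := (latLP y).1 Ly.
  have [c ic c1] := primitive_trace1 q_primitive.
  (* Twisting the trace identity of [q] gives the right-hand identity needed for [q~]. *)
  have tc1 : twist c * twist q + qconj (twist q) * qconj (twist c) = 1.
    rewrite -twistM -!twist_qconj -twistM -twistD c1.
    by apply: quat_eq; rewrite /= ?rmorph0 ?rmorph1.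
  have e1 : q * ((-1) ^+ f *: y) * twist q = k *: z.
    by rewrite qscaleAr qscaleAl -zy scalerA mulrA signK mul1r.
  have [||s1 [t1 [is1 it1 zE]]] := icosian_decomp _ ic c1 (icosian_twist ic) tc1
     _ k0 rs nq np e1.
  - by split=> //; icosian_closed.
  - by split=> //; oK_closed.
  (* The sign cancels the one in [alpha R q]; [1 - tau] is the conjugate of [tau]. *)
  exists ((-1) ^+ e *: (tau *: s1 + (1 - tau) *: twist t1)).
    by apply: icosianZ; [|icosian_closed].
  rewrite etaE /extension aE qscaleAl qscaleAr scalerA mulrAC signK mul1r.
  set A := conjK d *: (q * s1); set B := d *: (t1 * twist q).
  have -> : conjK d *: (q * (tau *: s1 + (1 - tau) *: twist t1)) =
      tau *: A + (1 - tau) *: twist B.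
    rewrite /A /B twistZ twistM twistK mulrDr !qscaleAr scalerDr !scalerA.
    by rewrite mulrC [_ * (1 - tau)]mulrC.
  rewrite -/A -/B in zE; clearbody A B.
  transitivity (tau *: z + (1 - tau) *: twist z).
    rewrite zE; move: (tau) conj_tau => t ct.
    rewrite !twistD !twistZ twistK rmorphB rmorph1 /= ct subKr.
    rewrite !scalerDr [X in _ + X = _]addrC addrACA.
    by rewrite [X in _ + X = _]addrC.
  by rewrite tz -scalerDl addrC subrK scale1r.
case=> _ [x ix <-] <-{v}; rewrite etaE; set w := extension R q * x.
have oa : oK (alpha R q) by rewrite aE; apply: oKM => //; oK_closed.
have iw : icosian w by rewrite /w /extension; icosian_closed.
split.
  exists (w + twist w) => //; apply/latLP; split; first by icosian_closed.
  by rewrite twistD twistK addrC.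
(* Chosen so that [q y0 q~] equals [(-1)^f k] times [w], by [conj q~ q~ = u d'^2]. This scalar is
   fixed by conjugation, so twisting gives the same relation for [y0~] and [w~]; adding the two
   settles the claim. *)
pose y0 := ((-1) ^+ e * (-1) ^+ f * d) *: (x * qconj (twist q)).
have iy0 : icosian y0.
  rewrite /y0; apply: icosianZ; last by icosian_closed.
  by apply: oKM => //; apply: oKM.
exists (y0 + twist y0).
  apply/latLP; split; first by icosian_closed.
  by rewrite twistD twistK addrC.
apply/esym/cslE.
have qy0 : q * y0 * twist q = ((-1) ^+ f * k) *: w.
  rewrite /w /extension /y0 qscaleAl [in RHS]scalerA qscaleAr qscaleAl.
  rewrite -!mulrA mul_qconjq np !qscaleAr mulr1 scalerA aE /k.
  by congr (_ *: _); ring.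
have ck : conjK ((-1) ^+ f * k) = (-1) ^+ f * k.
  by rewrite /k !rmorphM rmorph_int rmorph_sign /= conjKK; ring.
rewrite mulrDr mulrDl qy0 scalerDr; congr (_ + _).
by rewrite -{1}[q]twistK -!twistM mulrA qy0 twistZ ck.
Qed.
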